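(* Consider either of the two cases (Case 1 or Case 2 of the context) with the corresponding $\alpha_0$ and $C$. Then for every $\alpha\in(0,\alpha_0]$ the fixed point $w^\alpha$ of $T_\alpha$ satisfies $$\|w^\alpha-n\pi\otimes x_*\|_{\pi\otimes1_d}\le\frac{\alpha\rho}{1-\rho}\Big(1+\frac L\gamma\sqrt{\sum_{k=1}^n\frac1{\pi_k}}\Big)\Big(\frac{LR}{n\pi_{min}}+Q\Big),$$ where $\gamma=\frac{\bar L\mu}{\bar L+\mu}$, $Q=\|\nabla F(0)\|_{\pi\otimes1_d}$ and $\pi_{min}=\min_{1\le k\le n}\pi_k$.
   Context: Network: $G=(V,E)$ is a strongly connected directed graph on $V=\{1,\dots,n\}$. $W=(W_{ij})$ is a real nonnegative $n\times n$ matrix with $W_{ij}>0$ if $(i,j)\in E$ or $i=j$, and $W_{ij}=0$ otherwise; $W$ is column stochastic, $\sum_{k=1}^n W_{kj}=1$ for all $j$. $\pi=(\pi_1,\dots,\pi_n)^\top$ is the right eigenvector of $W$ with $W\pi=\pi$ and $\sum_j\pi_j=1$ (all $\pi_j>0$). $W^\infty=\pi1_n^\top$. With $\|v\|_\pi=(\sum_j\frac1{\pi_j}|v_j|^2)^{1/2}$ on $\mathbb{R}^n$ and $|||\cdot|||_\pi$ the induced matrix norm, $\rho=|||W-W^\infty|||_\pi$; it is a standing known fact that $\rho\in(0,1)$. A function is $L$-smooth if it is differentiable with $L$-Lipschitz gradient. For $w=(w_1^\top,\dots,w_n^\top)^\top\in\mathbb{R}^{nd}$ with $w_j\in\mathbb{R}^d$: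 $\|w\|_{\pi\otimes1_d}=\big(\sum_{j}\frac1{\pi_j}\|w_j\|^2\big)^{1/2}$; $\nabla F(w)=(\nabla f_1(w_1)^\top,\dots,\nabla f_n(w_n)^\top)^\top$; $J(w)\in\mathbb{R}^{nd}$ has $k$-th block $\sum_{j=1}^nW_{kj}w_j$; $T_\alpha(w)\in\mathbb{R}^{nd}$ has $k$-th block $\sum_{j=1}^nW_{kj}\big(w_j-\alpha\nabla f_j(\frac{w_j}{n\pi_j})\big)$. $\otimes$ is the Kronecker product, so $n\pi\otimes x_*$ has $j$-th block $n\pi_jx_*$. Case 1: for each $1\le k\le n$, $f_k:\mathbb{R}^d\to\mathbb{R}$ is $\mu_k$-strongly convex ($\mu_k>0$) and $L_k$-smooth; $\alpha_0=\min_k\frac{2n\pi_k}{L_k+\mu_k}$ and $C=\min_k\frac{\mu_kL_k}{n(\mu_k+L_k)\pi_k}$. Case 2: $f_k(x)=\frac12x^\top A_kx+B_kx$ with $A_k\in\mathbb{R}^{d\times d}$ symmetric positive semidefinite and $B_k\in\mathbb{R}^{1\times d}$, and $f=\frac1n\sum_kf_k$ is strongly convex; $L_k$ is the largest eigenvalue of $A_k$, $\alpha_0=\min_k\frac{2n\pi_k}{L_k+\epsilon}$ for a fixed arbitrary $\epsilon>0$, and $C=\frac{1-\eta_\epsilon}{\alpha_0}$, where $\eta_\epsilon\in(0,1)$ is a contraction constant of $T_{\alpha_0}$, i.e. $\|T_{\alpha_0}(x)-T_{\alpha_0}(y)\|_{\pi\otimes1_d}\le\eta_\epsilon\|x-y\|_{\pi\otimes1_d}$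 for all $x,y$ (such a constant exists). In both cases $\mu>0$ is a constant such that $f=\frac1n\sum_kf_k$ is $\mu$-strongly convex, $x_*$ is the unique minimizer of $f$, $w^\alpha$ is the unique fixed point of $T_\alpha$ for $\alpha\in(0,\alpha_0]$, $L=\max_kL_k$, $\bar L=\frac1n\sum_kL_k$, and $R=\frac1C\|J(\nabla F(0))\|_{\pi\otimes1_d}$. *)

(* Defs.v *)
From HB Require Import structures.
From mathcomp Require Import all_boot all_order all_algebra.
From mathcomp Require Import boolp classical_sets reals topology normedtype derive.

Set Implicit Arguments.
Unset Strict Implicit.
Unset Printing Implicit Defensive.

Import Order.TTheory GRing.Theory Num.Theory.
Import numFieldNormedType.Exports.

Local Open Scope classical_set_scope.
Local Open Scope ring_scope.

(* Points of R^d are row vectors.  A stacked vector w = (w_1, ..., w_n) of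
   R^(nd) is the n x d matrix whose k-th row is the block w_k. *)

Section FiniteExtrema.
Variables (R : realType) (n : nat).

Definition fmin (a : 'I_n.+1 -> R) : R :=
  \big[Num.min/a ord0]_(k < n.+1) a k.

Definition fmax (a : 'I_n.+1 -> R) : R :=
  \big[Num.max/a ord0]_(k < n.+1) a k.

End FiniteExtrema.

Section Functions.
Variables (R : realType) (d : nat).
Implicit Types (f : 'rV[R]_d -> R) (x y : 'rV[R]_d).

(* The library norm on matrices is the sup norm, hence this definition. *)
Definition enorm x : R := Num.sqrt (\sum_(j < d) x 0 j ^+ 2).

Definition grad f x : 'rV[R]_d := \row_(j < d) 'D_(delta_mx 0 j) f x.

Definition smooth (L : R) f : Prop :=
  (forall x, differentiable f x) /\
  (forall x y, enorm (grad f x - grad f y) <= L * enorm (x - y)).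

Definition strongly_convex (mu : R) f : Prop :=
  forall x y (t : R), 0 <= t <= 1 ->
    f (t *: x + (1 - t) *: y) <=
      t * f x + (1 - t) * f y - mu / 2 * t * (1 - t) * enorm (x - y) ^+ 2.

Definition minimizer f x : Prop := forall y, f x <= f y.

Definition quadratic (A : 'M[R]_d) (B : 'rV[R]_d) x : R :=
  2^-1 * (x *m A *m x^T) 0 0 + (B *m x^T) 0 0.

Definition psd (A : 'M[R]_d) : Prop :=
  A^T = A /\ forall x, 0 <= (x *m A *m x^T) 0 0.

Definition largest_eigenvalue (A : 'M[R]_d) (a : R) : Prop :=
  eigenvalue A a /\ forall b : R, eigenvalue A b -> b <= a.

End Functions.

Section Network.
Variables (R : realType) (n : nat).
Implicit Types (E : rel 'I_n) (W A : 'M[R]_n) (pi v : 'cV[R]_n).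

Definition strongly_connected E : Prop := forall i j, connect E i j.

Definition mixing_matrix E W : Prop :=
  [/\ forall i j, E i j || (i == j) -> 0 < W i j,
      forall i j, ~~ (E i j || (i == j)) -> W i j = 0 &
      forall j, \sum_(k < n) W k j = 1].

Definition stationary W pi : Prop :=
  [/\ W *m pi = pi, \sum_(j < n) pi j 0 = 1 & forall j, 0 < pi j 0].

Definition Winfty pi : 'M[R]_n := pi *m (const_mx 1 : 'rV[R]_n).

Definition norm_pi pi v : R :=
  Num.sqrt (\sum_(j < n) (pi j 0)^-1 * `|v j 0| ^+ 2).

Definition mxnorm_pi pi A : R :=
  sup [set norm_pi pi (A *m v) / norm_pi pi v | v in [set v | v != 0]].

Definition rho W pi : R := mxnorm_pi pi (W - Winfty pi).

End Network.

Section Algorithm.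
Variables (R : realType) (n d : nat).
Implicit Types (W : 'M[R]_n) (pi : 'cV[R]_n) (w : 'M[R]_(n, d)).
Implicit Types (f : 'I_n -> 'rV[R]_d -> R) (x : 'rV[R]_d).

(* The norm || . ||_(pi (x) 1_d). *)
Definition bnorm pi w : R :=
  Num.sqrt (\sum_(j < n) (pi j 0)^-1 * enorm (row j w) ^+ 2).

Definition aggregate f x : R := n%:R^-1 * \sum_(k < n) f k x.

Definition gradF f w : 'M[R]_(n, d) := \matrix_(k < n) grad (f k) (row k w).

Definition J W w : 'M[R]_(n, d) :=
  \matrix_(k < n) \sum_(j < n) W k j *: row j w.

Definition T W pi f (alpha : R) w : 'M[R]_(n, d) :=
  \matrix_(k < n) \sum_(j < n)
     W k j *: (row j w
               - alpha *: grad (f j) ((n%:R * pi j 0)^-1 *: row j w)).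

(* The Kronecker product n pi (x) x. *)
Definition npi_tens pi x : 'M[R]_(n, d) :=
  \matrix_(j < n) ((n%:R * pi j 0) *: x).

End Algorithm.

Section Cases.
Variables (R : realType) (n d : nat).
Variables (W : 'M[R]_n.+1) (pi : 'cV[R]_n.+1).
Variables (f : 'I_n.+1 -> 'rV[R]_d -> R) (Lk : 'I_n.+1 -> R) (alpha0 C : R).

Definition case1 (muk : 'I_n.+1 -> R) : Prop :=
  [/\ forall k, 0 < muk k,
      forall k, strongly_convex (muk k) (f k),
      forall k, smooth (Lk k) (f k),
      alpha0 = fmin (fun k => 2 * n.+1%:R * pi k 0 / (Lk k + muk k)) &
      C = fmin (fun k => muk k * Lk k / (n.+1%:R * (muk k + Lk k) * pi k 0))].

(* Strong convexity of the aggregate cost, also required in this case, is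
   a hypothesis common to the two cases and is stated separately. *)
Definition case2 (A : 'I_n.+1 -> 'M[R]_d) (B : 'I_n.+1 -> 'rV[R]_d)
    (eps eta : R) : Prop :=
  [/\ forall k, psd (A k) /\ (forall x, f k x = quadratic (A k) (B k) x),
      forall k, largest_eigenvalue (A k) (Lk k),
      0 < eps /\ alpha0 = fmin (fun k => 2 * n.+1%:R * pi k 0 / (Lk k + eps)),
      0 < eta < 1 /\
        (forall x y : 'M[R]_(n.+1, d),
           bnorm pi (T W pi f alpha0 x - T W pi f alpha0 y)
             <= eta * bnorm pi (x - y)) &
      C = (1 - eta) / alpha0].

End Cases.

(* Main.v *)
Require Import Defs.
From HB Require Import structures.
From mathcomp Require Import all_boot all_order all_algebra.
From mathcomp Require Import boolp classical_sets functions reals topology normedtype derive.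
From mathcomp Require Import ring lra.

(** Let w be a fixed point of T_alpha, let G be the vector of the gradients of
    the f_k at w_k / (n pi_k), and let xbar be the sum of the w_k divided by n,
    so that Winfty w = n pi (x) xbar.

    As W is column stochastic, the fixed point equation w = W (w - alpha G)
    forces the sum of the blocks of G to be zero, that is Winfty G = 0.
    Subtracting Winfty w gives
      D = (W - Winfty) (D - alpha G)   for   D = w - Winfty w,
    whence |D| <= alpha rho / (1 - rho) |G| (consensus_bound).  The gradients
    being Lipschitz, |G| <= L |w| / (n pimin) + Q (scaled_grad_bound), and
    |w| <= Rad because T_alpha contracts with the constant 1 - alpha C while
    T_alpha 0 = - alpha J (grad F 0) (fixed_point_bound).  Finally, since the
    gradients at w_k / (n pi_k) sum to zero, the gradient of the aggregate at
    xbar is bounded by a multiple of |D|, and strong convexity turns this into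
    a bound on n |xbar - xstar|, with 1 / mu <= 1 / gamma (optimality_gap).  The
    triangle inequality for w - n pi (x) xbar and n pi (x) (xbar - xstar)
    concludes (fixed_point_error).

    The remaining facts are the following.
    - rho < 1 (rho_lt1).  The loss norm_pi v ^+ 2 - norm_pi (W v) ^+ 2 is a sum
      of variances, which vanishes only on the multiples of pi because the
      graph is strongly connected.  Adding (sum v)^2 makes it positive
      definite, hence coercive, which gives a uniform contraction factor on
      the vectors of zero sum.
    - T_alpha contracts.  When the f_k are strongly convex this is the
      contraction of the gradient step, which rests on the coercivity of the
      gradient (grad_coercive).  When they are quadratic, T_alpha is a convex
      combination of J and of T_alpha0 (contraction_smaller_step).
    - For a quadratic f_k, the largest eigenvalue of A_k is a Lipschitz constant
      of the gradient (enorm_mulmx_psd). *)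

Set Implicit Arguments.
Unset Strict Implicit.
Unset Printing Implicit Defensive.

Import Order.TTheory GRing.Theory Num.Theory.
Import numFieldNormedType.Exports.

Local Open Scope ring_scope.

(** * Positive semidefinite forms and the norms *)

Section SemidefiniteForms.
Variables (R : realType) (V : lmodType R).

(** A symmetric positive semidefinite bilinear form on V.  Linearity is asked
    on the left only, the right one following by symmetry. *)
Definition psd_form (B : V -> V -> R) : Prop :=
  [/\ forall x y, B x y = B y x,
      forall a x y z, B (a *: x + y) z = a * B x z + B y z &
      forall x, 0 <= B x x].

Variable B : V -> V -> R.
Hypothesis Bpsd : psd_form B.

Lemma psformC x y : B x y = B y x. Proof. by case: Bpsd. Qed.

Lemma psform_ge0 x : 0 <= B x x. Proof. by case: Bpsd. Qed.

Lemma psformP a x y z : B (a *: x + y) z = a * B x z + B y z.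
Proof. by case: Bpsd. Qed.

Lemma psformDl x y z : B (x + y) z = B x z + B y z.
Proof. by have := psformP 1 x y z; rewrite scale1r mul1r. Qed.

Lemma psform0l z : B 0 z = 0.
Proof. by have := psformDl 0 0 z; rewrite addr0; lra. Qed.

Lemma psformZl a x z : B (a *: x) z = a * B x z.
Proof. by have := psformP a x 0 z; rewrite addr0 psform0l addr0. Qed.

Lemma psformNl x z : B (- x) z = - B x z.
Proof. by rewrite -scaleN1r psformZl mulN1r. Qed.

Lemma psformBl x y z : B (x - y) z = B x z - B y z.
Proof. by rewrite psformDl psformNl. Qed.

Lemma psformDr x y z : B x (y + z) = B x y + B x z.
Proof. by rewrite psformC psformDl psformC [B z x]psformC. Qed.

Lemma psformZr a x z : B x (a *: z) = a * B x z.
Proof. by rewrite psformC psformZl psformC. Qed.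

Lemma psformNr x z : B x (- z) = - B x z.
Proof. by rewrite psformC psformNl psformC. Qed.

Lemma psformBr x y z : B x (y - z) = B x y - B x z.
Proof. by rewrite psformDr psformNr. Qed.

Definition psformE := (psformDl, psformBl, psformZl, psformNl,
                       psformDr, psformBr, psformZr, psformNr).

(** The form may be degenerate: this is also used for the form x A y^T of a
    singular positive semidefinite matrix A. *)
Lemma psform_CauchySchwarz x y : B x y ^+ 2 <= B x x * B y y.
Proof.
have quad t : 0 <= B x x + 2 * t * B x y + t ^+ 2 * B y y.
  have := psform_ge0 (x + t *: y); rewrite !psformE (psformC y x); nra.
have [y0|/eqP y0] := eqVneq (B y y) 0.
  rewrite y0 mulr0; rewrite leNgt; apply/negP => xy_gt0.
  have xy0 : B x y != 0 by rewrite -sqrf_eq0 gt_eqF.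
  (* If B y y = 0 then quad is affine in t, and takes the value -1 here. *)
  have := quad (- (B x x + 1) / (2 * B x y)); rewrite y0.
  have -> : 2 * (- (B x x + 1) / (2 * B x y)) * B x y = - (B x x + 1) by field.
  by lra.
have yy_gt0 : 0 < B y y by rewrite lt_neqAle psform_ge0 eq_sym; move/eqP: y0 => ->.
have := quad (- B x y / B y y).
have -> : B x x + 2 * (- B x y / B y y) * B x y + (- B x y / B y y) ^+ 2 * B y y
   = (B x x * B y y - B x y ^+ 2) / B y y by field; lra.
by rewrite pmulr_lge0 ?invr_gt0 // subr_ge0.
Qed.

Lemma psform_le_norms x y : B x y <= Num.sqrt (B x x) * Num.sqrt (B y y).
Proof.
rewrite -sqrtrM ?psform_ge0 //; apply: (le_trans (ler_norm _)).
by rewrite -sqrtr_sqr ler_sqrt ?mulr_ge0 ?psform_ge0 // psform_CauchySchwarz.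
Qed.

Lemma psform_triangle x y :
  Num.sqrt (B (x + y) (x + y)) <= Num.sqrt (B x x) + Num.sqrt (B y y).
Proof.
have sge0 z := sqrtr_ge0 (B z z).
rewrite -[leRHS]ger0_norm ?addr_ge0 // -sqrtr_sqr ler_sqrt ?sqr_ge0 //.
rewrite sqrrD !sqr_sqrtr ?psform_ge0 // !psformE (psformC y x).
have := psform_le_norms x y; rewrite mulr2n; lra.
Qed.

Lemma psform_normZ a x :
  Num.sqrt (B (a *: x) (a *: x)) = `|a| * Num.sqrt (B x x).
Proof. by rewrite !psformE mulrA -expr2 sqrtrM ?sqr_ge0 // sqrtr_sqr. Qed.

End SemidefiniteForms.

Section Norms.
Variable R : realType.

(** The Euclidean inner product of row vectors. *)
Definition dot d (x y : 'rV[R]_d) : R := (x *m y^T) 0 0.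

(** The inner product of stacked vectors whose norm is bnorm pi. *)
Definition bdot n d (pi : 'cV[R]_n) (x y : 'M[R]_(n, d)) : R :=
  \sum_(j < n) (pi j 0)^-1 * dot (row j x) (row j y).

Lemma dotE d (x y : 'rV[R]_d) : dot x y = \sum_(j < d) x 0 j * y 0 j.
Proof. by rewrite /dot mxE; apply: eq_bigr => j _; rewrite mxE. Qed.

Lemma dot_psd d : psd_form (@dot d).
Proof.
split=> [x y|a x y z|x].
- by rewrite !dotE; apply: eq_bigr => j _; rewrite mulrC.
- by rewrite /dot mulmxDl -scalemxAl !mxE.
- by rewrite dotE sumr_ge0 // => j _; rewrite -expr2 sqr_ge0.
Qed.

Lemma dot_eq0 d (x : 'rV[R]_d) : dot x x = 0 -> x = 0.
Proof.
rewrite dotE => /eqP; rewrite psumr_eq0 => [/allP x0|j _]; last first.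
  by rewrite -expr2 sqr_ge0.
apply/rowP => j; have := x0 j (mem_index_enum j).
by rewrite -expr2 sqrf_eq0 => /eqP ->; rewrite mxE.
Qed.

Lemma bdot_psd n d (pi : 'cV[R]_n) : (forall j, 0 < pi j 0) ->
  psd_form (@bdot n d pi).
Proof.
move=> pi_gt0; split=> [x y|a x y z|x].
- by apply: eq_bigr => j _; rewrite (psformC (dot_psd d)).
- rewrite mulr_sumr -big_split /=; apply: eq_bigr => j _.
  by rewrite linearP (psformP (dot_psd d)); ring.
- apply: sumr_ge0 => j _.
  by rewrite mulr_ge0 ?invr_ge0 ?(ltW (pi_gt0 j)) // (psform_ge0 (dot_psd d)).
Qed.

Lemma enormE d (x : 'rV[R]_d) : enorm x = Num.sqrt (dot x x).
Proof. by rewrite dotE. Qed.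

Lemma enorm_ge0 d (x : 'rV[R]_d) : 0 <= enorm x.
Proof. exact: sqrtr_ge0. Qed.

Lemma enorm_sqr d (x : 'rV[R]_d) : enorm x ^+ 2 = dot x x.
Proof. by rewrite enormE sqr_sqrtr // (psform_ge0 (dot_psd d)). Qed.

Lemma enormD d (x y : 'rV[R]_d) : enorm (x + y) <= enorm x + enorm y.
Proof. by rewrite !enormE; exact: psform_triangle (dot_psd d) x y. Qed.

Lemma enormZ d a (x : 'rV[R]_d) : enorm (a *: x) = `|a| * enorm x.
Proof. by rewrite !enormE; exact: psform_normZ (dot_psd d) a x. Qed.

Lemma enormN d (x : 'rV[R]_d) : enorm (- x) = enorm x.
Proof. by rewrite -scaleN1r enormZ normrN1 mul1r. Qed.

Lemma enorm_gt0 d (x : 'rV[R]_d) : x != 0 -> 0 < enorm x.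
Proof.
move=> x0; rewrite lt_neqAle enorm_ge0 andbT eq_sym.
apply: contraNneq x0 => e0; apply/eqP/dot_eq0.
by rewrite -enorm_sqr e0 expr0n.
Qed.

Lemma enorm_sum d (I : finType) (F : I -> 'rV[R]_d) :
  enorm (\sum_i F i) <= \sum_i enorm (F i).
Proof.
elim/big_ind2: _ => [|x a y b xa yb|//]; last first.
  by apply: le_trans (enormD _ _) _; rewrite lerD.
by rewrite -(scale0r (0 : 'rV[R]_d)) enormZ normr0 mul0r.
Qed.

Lemma dot_le_enorm d (x y : 'rV[R]_d) : dot x y <= enorm x * enorm y.
Proof. by rewrite !enormE; exact: psform_le_norms (dot_psd d) x y. Qed.

Lemma enorm_le d (x : 'rV[R]_d) b : 0 <= b -> dot x x <= b ^+ 2 -> enorm x <= b.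
Proof. by move=> b0; rewrite -enorm_sqr ler_pXn2r // nnegrE ?enorm_ge0. Qed.

Section WeightedNorm.
Variables (n d : nat) (pi : 'cV[R]_n).
Hypothesis pi_gt0 : forall j, 0 < pi j 0.

Lemma bnormE (x : 'M[R]_(n, d)) : bnorm pi x = Num.sqrt (bdot pi x x).
Proof. by congr (Num.sqrt _); apply: eq_bigr => j _; rewrite enorm_sqr. Qed.

Lemma bnorm_ge0 (x : 'M[R]_(n, d)) : 0 <= bnorm pi x.
Proof. exact: sqrtr_ge0. Qed.

Lemma bnorm_sqr (x : 'M[R]_(n, d)) : bnorm pi x ^+ 2 = bdot pi x x.
Proof. by rewrite bnormE sqr_sqrtr // (psform_ge0 (bdot_psd d pi_gt0)). Qed.

Lemma bnormD (x y : 'M[R]_(n, d)) : bnorm pi (x + y) <= bnorm pi x + bnorm pi y.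
Proof. by rewrite !bnormE; exact: psform_triangle (bdot_psd d pi_gt0) x y. Qed.

Lemma bnormZ a (x : 'M[R]_(n, d)) : bnorm pi (a *: x) = `|a| * bnorm pi x.
Proof. by rewrite !bnormE; exact: psform_normZ (bdot_psd d pi_gt0) a x. Qed.

Lemma bnormN (x : 'M[R]_(n, d)) : bnorm pi (- x) = bnorm pi x.
Proof. by rewrite -scaleN1r bnormZ normrN1 mul1r. Qed.

Lemma bnormB (x y : 'M[R]_(n, d)) : bnorm pi (x - y) <= bnorm pi x + bnorm pi y.
Proof. by rewrite -(bnormN y) bnormD. Qed.

Lemma bnorm_le_scale (x y : 'M[R]_(n, d)) c : 0 <= c ->
  (forall j, enorm (row j x) ^+ 2 <= c ^+ 2 * enorm (row j y) ^+ 2) ->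
  bnorm pi x <= c * bnorm pi y.
Proof.
move=> c0 xy; rewrite -(ler_pXn2r (n := 2)) ?nnegrE ?mulr_ge0 ?bnorm_ge0 //.
rewrite exprMn !bnorm_sqr mulr_sumr; apply: ler_sum => j _.
rewrite [leRHS]mulrCA -!enorm_sqr ler_wpM2l //.
by rewrite invr_ge0 ltW.
Qed.

(** The columns of a stacked vector are orthogonal to one another, so that
    the weighted norm is computed column by column. *)
Lemma bdot_col (x : 'M[R]_(n, d)) :
  bdot pi x x = \sum_(i < d) norm_pi pi (col i x) ^+ 2.
Proof.
rewrite /bdot; under eq_bigr do rewrite dotE mulr_sumr.
rewrite exchange_big /=; apply: eq_bigr => i _.
rewrite sqr_sqrtr; last first.
  by apply: sumr_ge0 => j _; rewrite mulr_ge0 ?sqr_ge0 // invr_ge0 ltW.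
by apply: eq_bigr => j _; rewrite !mxE real_normK ?num_real // expr2.
Qed.

End WeightedNorm.
End Norms.

(** * Symmetric positive semidefinite matrices *)

Section SemidefiniteMatrices.
Variables (R : realType) (d : nat).
Implicit Types (A S : 'M[R]_d) (x y : 'rV[R]_d).

Lemma dot_mulmxl A x y : dot (x *m A) y = dot x (y *m A^T).
Proof. by rewrite /dot trmx_mul trmxK mulmxA. Qed.

Lemma psd_mx_form S : psd S -> psd_form (fun x y => dot (x *m S) y).
Proof.
case=> Ssym Spos; split=> [x y|a x y z|x].
- by rewrite dot_mulmxl Ssym (psformC (dot_psd R d)).
- by rewrite mulmxDl -scalemxAl (psformP (dot_psd R d)).
- exact: Spos.
Qed.

Lemma mulmx_bounded A :
  exists2 c : R, 0 < c & forall x, dot (x *m A) (x *m A) <= c * dot x x.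
Proof.
pose c := \sum_(j < d) dot (col j A)^T (col j A)^T.
have c_ge0 : 0 <= c by apply: sumr_ge0 => j _; exact: psform_ge0 (dot_psd R d) _.
exists (1 + c); first by lra.
move=> x; have xx_ge0 := psform_ge0 (dot_psd R d) x.
suff : dot (x *m A) (x *m A) <= c * dot x x by lra.
rewrite [leLHS]dotE mulr_suml; apply: ler_sum => j _.
rewrite -expr2; have -> : (x *m A) 0 j = dot x (col j A)^T.
  by rewrite /dot trmxK !mxE; apply: eq_bigr => k _; rewrite mxE.
by rewrite mulrC; exact: psform_CauchySchwarz (dot_psd R d) _ _.
Qed.

(** The square of S is at most c S as soon as S is at most c: this is the
    Cauchy-Schwarz inequality of the form S for x and x S. *)
Lemma psd_sqr_le S c x : psd S -> 0 <= c ->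
  (forall y, dot (y *m S) y <= c * dot y y) ->
  dot (x *m S) (x *m S) <= c * dot (x *m S) x.
Proof.
move=> Spsd c_ge0 Sc; have Sform := psd_mx_form Spsd.
have := psform_CauchySchwarz Sform x (x *m S).
have := Sc (x *m S); have := psform_ge0 Sform x.
have := psform_ge0 (dot_psd R d) (x *m S).
set q := dot (x *m S) (x *m S); set p := dot (x *m S) x.
set r := dot (x *m S *m S) _ => q_ge0 p_ge0 rq qpr.
have : q * q <= p * (c * q) by rewrite -expr2 (le_trans qpr) // ler_wpM2l.
move: q_ge0; rewrite le_eqVlt => /predU1P[<- _|q_gt0].
  by rewrite mulr_ge0.
by rewrite mulrA ler_pM2r // mulrC.
Qed.

(** A semidefinite invertible matrix is bounded below by a positive multiple of
    the identity, since |x| <= |S^-1| |x S| and |x S|^2 <= c (x S x^T). *)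
Lemma psd_unit_coercive S : psd S -> S \in unitmx ->
  exists2 c : R, 0 < c & forall x, c * dot x x <= dot (x *m S) x.
Proof.
move=> Spsd Sunit.
have [a a_gt0 Sa] := mulmx_bounded S.
have [b b_gt0 Sb] := mulmx_bounded (invmx S).
have Sc y : dot (y *m S) y <= (1 + a) * dot y y.
  have := psform_ge0 (dot_psd R d) (y *m S - y); have := Sa y.
  have := psform_ge0 (dot_psd R d) y; have := psform_ge0 (psd_mx_form Spsd) y.
  rewrite /= !(psformE (dot_psd R d)) (psformC (dot_psd R d) y (y *m S)); nra.
have a1_ge0 : 0 <= 1 + a by lra.
exists (b * (1 + a))^-1; first by rewrite invr_gt0 mulr_gt0 //; lra.
move=> x; rewrite ler_pdivrMl ?mulr_gt0 //; last by lra.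
rewrite -mulrA; have := Sb (x *m S); rewrite mulmxK // => /le_trans; apply.
by rewrite ler_wpM2l ?(ltW b_gt0) // psd_sqr_le.
Qed.

Lemma mulmx_inj_unit S : (forall x, x *m S = 0 -> x = 0) -> S \in unitmx.
Proof. by move=> inj; rewrite -row_free_unit; exact: inj_row_free. Qed.

(** The supremum s of the Rayleigh quotient is an eigenvalue: otherwise s - A
    would be semidefinite and invertible, hence coercive, and the quotient
    would stay away from s.  Neither compactness of the sphere nor a spectral
    decomposition is needed. *)
Lemma psd_le_max_eigenvalue A (l : R) : psd A ->
  (forall b, eigenvalue A b -> b <= l) ->
  forall x, dot (x *m A) x <= l * dot x x.
Proof.
move=> Apsd Al x; have dotP := dot_psd R d; have Aform := psd_mx_form Apsd.
have dot_gt0 y : y != 0 -> 0 < dot y y.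
  move=> y0; rewrite lt_neqAle (psform_ge0 dotP) andbT eq_sym.
  by apply: contraNneq y0 => /dot_eq0 ->.
have [->|x0] := eqVneq x 0.
  by rewrite mul0mx !(psform0l dotP) mulr0.
pose r y := dot (y *m A) y / dot y y.
pose E := [set r y | y in [set y | y != 0]]%classic.
have [c c_gt0 Ac] := mulmx_bounded A.
have supE : has_sup E.
  split; first by exists (r x), x.
  exists (1 + c) => _ [y /= y0 <-]; rewrite ler_pdivrMr ?dot_gt0 //.
  have := psform_ge0 dotP (y *m A - y); have := Ac y.
  have := psform_ge0 dotP y; have := psform_ge0 Aform y.
  rewrite /= !(psformE dotP) (psformC dotP y (y *m A)); nra.
have rE y : y != 0 -> dot (y *m A) y <= sup E * dot y y.
  move=> y0; rewrite -ler_pdivrMr ?dot_gt0 //.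
  by apply: ub_le_sup; [case: supE|exists y].
rewrite -ler_pdivrMr ?dot_gt0 // (le_trans (y := sup E)) //.
  by apply: ub_le_sup; [case: supE|exists x].
apply: Al; apply: contraT; rewrite /eigenvalue /eigenspace negbK kermx_eq0.
rewrite row_free_unit => Aunit.
pose S := (sup E)%:M - A.
have SE y : dot (y *m S) y = sup E * dot y y - dot (y *m A) y.
  by rewrite mulmxBr mul_mx_scalar !(psformE dotP).
have Spsd : psd S.
  split; first by rewrite /S linearB /= tr_scalar_mx; case: Apsd => ->.
  move=> y; change (0 <= dot (y *m S) y); rewrite SE subr_ge0.
  have [->|/rE //] := eqVneq y 0.
  by rewrite mul0mx !(psform0l dotP) mulr0.
have [|e e_gt0 Se] := psd_unit_coercive Spsd.
  by rewrite -row_free_unit /S -opprB row_free_unit -scaleN1r unitmxZ ?unitrN1.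
have : sup E <= sup E - e.
  apply: ge_sup; first by case: supE.
  move=> _ [y /= y0 <-]; rewrite ler_pdivrMr ?dot_gt0 //.
  by have := Se y; rewrite SE; lra.
by lra.
Qed.

Lemma eigenvalue_psd_ge0 A a : psd A -> eigenvalue A a -> 0 <= a.
Proof.
move=> Apsd /eigenvalueP[v vA v0]; have := psform_ge0 (psd_mx_form Apsd) v.
rewrite /= vA (psformE (dot_psd R d)) pmulr_lge0 // -enorm_sqr.
by rewrite exprn_gt0 // enorm_gt0.
Qed.

Lemma enorm_mulmx_psd A (l : R) x : psd A -> largest_eigenvalue A l ->
  enorm (x *m A) <= l * enorm x.
Proof.
move=> Apsd [Al lmax]; have l_ge0 := eigenvalue_psd_ge0 Apsd Al.
have Ale := psd_le_max_eigenvalue Apsd lmax.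
apply: enorm_le; first by rewrite mulr_ge0 // enorm_ge0.
rewrite exprMn enorm_sqr (le_trans (psd_sqr_le x Apsd l_ge0 Ale)) //.
by rewrite expr2 -mulrA ler_wpM2l.
Qed.

End SemidefiniteMatrices.

(** * The mixing matrix is a contraction on vectors of zero sum *)

Section Mixing.
Variables (R : realType) (n : nat).
Variables (E : rel 'I_n.+1) (W : 'M[R]_n.+1) (pi : 'cV[R]_n.+1).
Hypothesis Econn : strongly_connected E.
Hypothesis Wmix : mixing_matrix E W.
Hypothesis Wpi : stationary W pi.
Implicit Types (v : 'cV[R]_n.+1) (k j : 'I_n.+1).

Let pi_gt0 j : 0 < pi j 0. Proof. by case: Wpi. Qed.

Let pi_neq0 j : pi j 0 != 0. Proof. by rewrite gt_eqF. Qed.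

Lemma mixing_ge0 k j : 0 <= W k j.
Proof.
case: Wmix => Wpos W0 _; have [/Wpos/ltW //|/W0 ->] := boolP (E k j || (k == j)).
exact: lexx.
Qed.

Lemma norm_pi_sqr v : norm_pi pi v ^+ 2 = \sum_j (pi j 0)^-1 * v j 0 ^+ 2.
Proof.
rewrite sqr_sqrtr; last first.
  by apply: sumr_ge0 => j _; rewrite mulr_ge0 ?sqr_ge0 // invr_ge0 ltW.
by apply: eq_bigr => j _; rewrite real_normK ?num_real.
Qed.

Lemma norm_pi_ge0 v : 0 <= norm_pi pi v.
Proof. exact: sqrtr_ge0. Qed.

Lemma norm_pi_le v b : 0 <= b -> norm_pi pi v ^+ 2 <= b ^+ 2 -> norm_pi pi v <= b.
Proof. by move=> b_ge0; rewrite ler_pXn2r // nnegrE norm_pi_ge0. Qed.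

Lemma norm_pi_gt0 v : v != 0 -> 0 < norm_pi pi v.
Proof.
move=> v0; rewrite lt_neqAle norm_pi_ge0 andbT eq_sym.
apply: contraNneq v0 => /(congr1 (fun a => a ^+ 2)).
rewrite norm_pi_sqr expr0n /= => /eqP; rewrite psumr_eq0 => [/allP s0|j _].
  apply/eqP/colP => j; have := s0 j (mem_index_enum j).
  by rewrite mulf_eq0 invr_eq0 (negPf (pi_neq0 j)) sqrf_eq0 mxE => /eqP.
by rewrite mulr_ge0 ?sqr_ge0 // invr_ge0 ltW.
Qed.

(** The k-th row of W, weighted by pi, is a measure of mass pi_k; the loss of
    norm under W is the sum of the (unnormalized) variances of v / pi for these
    measures. *)
Lemma norm_pi_mulW v :
  norm_pi pi v ^+ 2 - norm_pi pi (W *m v) ^+ 2 =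
  \sum_k \sum_j W k j * pi j 0 * (v j 0 / pi j 0 - (W *m v) k 0 / pi k 0) ^+ 2.
Proof.
have Wpik k : \sum_j W k j * pi j 0 = pi k 0.
  by case: Wpi => /colP/(_ k); rewrite mxE.
rewrite !norm_pi_sqr.
have -> : \sum_j (pi j 0)^-1 * v j 0 ^+ 2 =
          \sum_k \sum_j W k j * ((pi j 0)^-1 * v j 0 ^+ 2).
  rewrite exchange_big /=; apply: eq_bigr => j _.
  by rewrite -mulr_suml; case: Wmix => _ _ ->; rewrite mul1r.
rewrite -sumrB; apply: eq_bigr => k _.
set m := (W *m v) k 0.
have mE : m = \sum_j W k j * v j 0 by rewrite /m mxE.
transitivity (\sum_j (W k j * ((pi j 0)^-1 * v j 0 ^+ 2)
   - 2 * (m / pi k 0) * (W k j * v j 0) + (m / pi k 0) ^+ 2 * (W k j * pi j 0))).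
  rewrite big_split sumrB /= -!mulr_sumr -mE Wpik.
  by field.
by apply: eq_bigr => j _; field; rewrite !pi_neq0.
Qed.

Lemma norm_pi_mulW_le v : norm_pi pi (W *m v) <= norm_pi pi v.
Proof.
apply: norm_pi_le; first exact: norm_pi_ge0.
rewrite -subr_ge0 norm_pi_mulW; apply: sumr_ge0 => k _; apply: sumr_ge0 => j _.
exact: mulr_ge0 (mulr_ge0 (mixing_ge0 k j) (ltW (pi_gt0 j))) (sqr_ge0 _).
Qed.

(** The variances vanish only if v / pi is constant along the edges of the
    graph, the loops k -> k included, hence constant by connectedness. *)
Lemma norm_pi_mulW_eq v :
  norm_pi pi v ^+ 2 - norm_pi pi (W *m v) ^+ 2 = 0 ->
  forall i j, v i 0 / pi i 0 = v j 0 / pi j 0.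
Proof.
rewrite norm_pi_mulW => /eqP.
have term_ge0 k j :
    0 <= W k j * pi j 0 * (v j 0 / pi j 0 - (W *m v) k 0 / pi k 0) ^+ 2.
  exact: mulr_ge0 (mulr_ge0 (mixing_ge0 k j) (ltW (pi_gt0 j))) (sqr_ge0 _).
rewrite psumr_eq0 => [/allP s0|k _]; last exact: sumr_ge0.
have Wkj k j : E k j || (k == j) -> v j 0 / pi j 0 = (W *m v) k 0 / pi k 0.
  case: Wmix => Wpos _ _ /Wpos Wkj_gt0.
  have := s0 k (mem_index_enum k); rewrite psumr_eq0 // => /allP.
  move=> /(_ j (mem_index_enum j)).
  by rewrite 2!mulf_eq0 (gt_eqF Wkj_gt0) (negPf (pi_neq0 j)) sqrf_eq0 subr_eq0 => /eqP.
have step k j : E k j -> v k 0 / pi k 0 = v j 0 / pi j 0.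
  by move=> Ekj; rewrite (Wkj k k) ?eqxx ?orbT // (Wkj k j) ?Ekj.
move=> i j; have /connectP[p] := Econn i j.
elim: p i => [|k p IHp] i /=; first by move=> _ ->.
by move=> /andP[/step -> Ep] /(IHp k Ep).
Qed.

(** Strictness of the contraction is made uniform by the coercivity of the
    positive definite matrix of the form
    norm_pi v ^+ 2 - norm_pi (W v) ^+ 2 + (sum v) ^+ 2. *)
Lemma norm_pi_mulW_sum0 : exists2 q : R, 0 <= q < 1 &
  forall v, \sum_j v j 0 = 0 -> norm_pi pi (W *m v) <= q * norm_pi pi v.
Proof.
pose D : 'M[R]_n.+1 := diag_mx (\row_j (pi j 0)^-1).
pose U : 'M[R]_n.+1 := const_mx 1.
pose S := D - W^T *m D *m W + U.
have DE v : (v^T *m D *m v) 0 0 = norm_pi pi v ^+ 2.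
  rewrite norm_pi_sqr mxE; apply: eq_bigr => j _.
  by rewrite mul_mx_diag !mxE; ring.
have SE (x : 'rV[R]_n.+1) : dot (x *m S) x =
    norm_pi pi x^T ^+ 2 - norm_pi pi (W *m x^T) ^+ 2 + (\sum_j x 0 j) ^+ 2.
  rewrite /dot /S mulmxDr mulmxBr mulmxDl mulmxBl mxE [X in X + _]mxE.
  congr (_ + _ + _).
  - by rewrite -DE trmxK.
  - by rewrite mxE -DE trmx_mul trmxK !mulmxA.
  rewrite mxE expr2 mulr_sumr; apply: eq_bigr => j _; rewrite !mxE.
  by congr (_ * _); apply: eq_bigr => k _; rewrite mxE mulr1.
have diff_ge0 v : 0 <= norm_pi pi v ^+ 2 - norm_pi pi (W *m v) ^+ 2.
  by rewrite subr_ge0 ler_pXn2r ?nnegrE ?norm_pi_ge0 // norm_pi_mulW_le.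
have Spsd : psd S.
  split; last by move=> x; rewrite [leRHS]SE addr_ge0 ?sqr_ge0.
  by rewrite /S !linearD /= linearN /= !trmx_mul trmxK tr_diag_mx trmx_const mulmxA.
have Sunit : S \in unitmx.
  apply: mulmx_inj_unit => x xS0.
  have := SE x; rewrite xS0 (psform0l (dot_psd R n.+1)) => /esym/eqP.
  rewrite paddr_eq0 ?sqr_ge0 // sqrf_eq0 => /andP[/eqP eqW /eqP sum0].
  have prop := norm_pi_mulW_eq eqW.
  have xE j : x 0 j = x 0 ord0 / pi ord0 0 * pi j 0.
    by have := prop ord0 j; rewrite !mxE => ->; rewrite divfK.
  have : x 0 ord0 / pi ord0 0 = 0.
    rewrite -sum0 (eq_bigr _ (fun j _ => xE j)) -mulr_sumr.
    by case: Wpi => _ -> _; rewrite mulr1.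
  by move=> x00; apply/rowP => j; rewrite xE x00 mul0r mxE.
have [c c_gt0 Sc] := psd_unit_coercive Spsd Sunit.
pose m := fmin (fun k => pi k 0).
have m_le k : m <= pi k 0 by apply: bigmin_le.
have m_gt0 : 0 < m by apply: lt_bigmin.
pose q := Num.sqrt (1 - c * m).
have q_lt1 : q < 1.
  by rewrite -sqrtr1 ltr_sqrt // gtrBl mulr_gt0.
exists q; first by rewrite sqrtr_ge0.
move=> v sum0; have := Sc v^T.
rewrite SE trmxK.
have -> : \sum_j v^T 0 j = 0 by rewrite -[RHS]sum0; apply: eq_bigr => j _; rewrite mxE.
have : m * norm_pi pi v ^+ 2 <= dot v^T v^T.
  rewrite dotE norm_pi_sqr mulr_sumr; apply: ler_sum => j _.
  rewrite mxE -expr2 mulrA -[leRHS]mul1r ler_wpM2r ?sqr_ge0 //.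
  by rewrite ler_pdivrMr // mul1r.
move=> le1 le2.
have le3 : norm_pi pi (W *m v) ^+ 2 <= (1 - c * m) * norm_pi pi v ^+ 2.
  have : c * (m * norm_pi pi v ^+ 2) <= c * dot v^T v^T by rewrite ler_wpM2l // ltW.
  by rewrite expr0n addr0 in le2; lra.
(* When 1 - c m < 0 the root q is 0 by convention, and le3 forces both sides
   to vanish. *)
have [cm|cm] := lerP 0 (1 - c * m).
  apply: norm_pi_le; first by rewrite mulr_ge0 ?sqrtr_ge0.
  by rewrite exprMn [q ^+ 2]sqr_sqrtr.
apply: norm_pi_le; first by rewrite mulr_ge0 ?sqrtr_ge0.
rewrite (le_trans le3) // (le_trans (y := 0)) ?sqr_ge0 //.
by rewrite mulr_le0_ge0 ?sqr_ge0 // ltW.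
Qed.

Lemma Winfty_mul v k : (Winfty pi *m v) k 0 = pi k 0 * \sum_j v j 0.
Proof.
rewrite /Winfty -mulmxA mxE big_ord1; congr (_ * _).
by rewrite mxE; apply: eq_bigr => j _; rewrite mxE mul1r.
Qed.

(** v - Winfty v is the orthogonal projection of v on the vectors of zero
    sum. *)
Lemma norm_pi_center v : norm_pi pi (v - Winfty pi *m v) <= norm_pi pi v.
Proof.
apply: norm_pi_le; first exact: norm_pi_ge0.
rewrite !norm_pi_sqr; set s := \sum_j v j 0.
have -> : \sum_j (pi j 0)^-1 * (v - Winfty pi *m v) j 0 ^+ 2 =
  \sum_j ((pi j 0)^-1 * v j 0 ^+ 2 - 2 * s * v j 0 + s ^+ 2 * pi j 0).
  apply: eq_bigr => j _; rewrite mxE [X in _ + X]mxE Winfty_mul -/s.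
  by field.
rewrite big_split sumrB /= -!mulr_sumr -/s; case: Wpi => _ -> _.
have := sqr_ge0 s; lra.
Qed.

Lemma mulW_sub_Winfty m (w : 'M[R]_(n.+1, m)) :
  (W - Winfty pi) *m w = W *m (w - Winfty pi *m w).
Proof.
rewrite mulmxBl mulmxBr; congr (_ - _).
by rewrite /Winfty !mulmxA; case: Wpi => ->.
Qed.

(** W - Winfty is W preceded by the projection on the vectors of zero sum. *)
Lemma contraction_exists : exists2 q : R, 0 <= q < 1 &
  forall v, norm_pi pi ((W - Winfty pi) *m v) <= q * norm_pi pi v.
Proof.
have [q /andP[q_ge0 q_lt1] Wq] := norm_pi_mulW_sum0.
exists q; first by rewrite q_ge0.
move=> v; rewrite mulW_sub_Winfty; apply: le_trans (Wq _ _) _; last first.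
  by rewrite ler_wpM2l // norm_pi_center.
have -> : \sum_j (v - Winfty pi *m v) j 0
   = \sum_j (v j 0 - pi j 0 * \sum_j v j 0).
  by apply: eq_bigr => j _; rewrite mxE [X in _ + X]mxE Winfty_mul.
by rewrite sumrB -mulr_suml; case: Wpi => _ -> _; rewrite mul1r subrr.
Qed.

Let quotients :=
  [set norm_pi pi ((W - Winfty pi) *m v) / norm_pi pi v | v in [set v | v != 0]]%classic.

Let ones_neq0 : (const_mx 1 : 'cV[R]_n.+1) != 0.
Proof. by apply/eqP => /colP/(_ ord0)/eqP; rewrite !mxE oner_eq0. Qed.

Let has_sup_quotients : has_sup quotients.
Proof.
have [q _ Wq] := contraction_exists.
split; first by eexists; exists (const_mx 1).
by exists q => _ [v /= v0 <-]; rewrite ler_pdivrMr ?norm_pi_gt0.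
Qed.

(** The supremum defining rho is taken over a nonempty bounded set, thus is an
    actual least upper bound. *)
Lemma norm_pi_rho v : norm_pi pi ((W - Winfty pi) *m v) <= rho W pi * norm_pi pi v.
Proof.
have [->|v0] := eqVneq v 0.
  by rewrite mulmx0 -(scale0r (0 : 'cV[R]_n.+1)) /norm_pi !big1 ?sqrtr0 ?mulr0 // => j _;
    rewrite !mxE mul0r normr0 expr0n mulr0.
rewrite -ler_pdivrMr ?norm_pi_gt0 //.
by apply: ub_le_sup; [case: has_sup_quotients|exists v].
Qed.

Lemma rho_ge0 : 0 <= rho W pi.
Proof.
have := norm_pi_rho (const_mx 1); have := norm_pi_gt0 ones_neq0.
by move=> v_gt0 /(le_trans (norm_pi_ge0 _)); rewrite pmulr_lge0.
Qed.

Lemma rho_lt1 : rho W pi < 1.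
Proof.
have [q /andP[_ q_lt1] Wq] := contraction_exists.
apply: le_lt_trans q_lt1; apply: ge_sup; first by case: has_sup_quotients.
by move=> _ [v /= v0 <-]; rewrite ler_pdivrMr ?norm_pi_gt0.
Qed.

Lemma bnorm_mulmx_le d (A : 'M[R]_n.+1) (c : R) (w : 'M[R]_(n.+1, d)) : 0 <= c ->
  (forall v, norm_pi pi (A *m v) <= c * norm_pi pi v) ->
  bnorm pi (A *m w) <= c * bnorm pi w.
Proof.
move=> c_ge0 Ac.
rewrite -(ler_pXn2r (n := 2)) ?nnegrE ?mulr_ge0 ?bnorm_ge0 //.
rewrite exprMn !(bnorm_sqr pi_gt0) !(bdot_col pi_gt0) mulr_sumr.
apply: ler_sum => i _; have -> : col i (A *m w) = A *m col i w.
  by rewrite !colE mulmxA.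
rewrite -exprMn.
by rewrite ler_pXn2r ?nnegrE ?mulr_ge0 ?norm_pi_ge0.
Qed.

Lemma bnorm_mulW d (w : 'M[R]_(n.+1, d)) : bnorm pi (W *m w) <= bnorm pi w.
Proof.
rewrite -[leRHS]mul1r; apply: bnorm_mulmx_le => // v.
by rewrite mul1r norm_pi_mulW_le.
Qed.

Lemma bnorm_rho d (w : 'M[R]_(n.+1, d)) :
  bnorm pi ((W - Winfty pi) *m w) <= rho W pi * bnorm pi w.
Proof. by apply: bnorm_mulmx_le norm_pi_rho; exact: rho_ge0. Qed.

End Mixing.

(** * Gradients of smooth and strongly convex functions *)

Section Gradients.
Local Open Scope classical_set_scope.
Local Open Scope ring_scope.
Variables (R : realType) (d : nat).
Implicit Types (f g : 'rV[R]_d -> R) (x y u v : 'rV[R]_d) (A : 'M[R]_d).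

Let dotP := dot_psd R d.

(** All the directional derivatives of f exist and are given by its gradient.
    This is weaker than differentiability, and all that the argument uses. *)
Definition has_grad f : Prop :=
  forall x v, is_derive x v f (dot (grad f x) v).

(** The gradient is L-Lipschitz for the Euclidean norm. *)
Definition lipschitz_grad (L : R) f : Prop :=
  forall x y, enorm (grad f x - grad f y) <= L * enorm (x - y).

Lemma enorm_pos_exists : (0 < d)%N -> exists x, 0 < enorm x.
Proof.
case: d => // d' _; exists (const_mx 1); apply: enorm_gt0.
by apply/eqP => /rowP/(_ ord0)/eqP; rewrite !mxE oner_eq0.
Qed.

Lemma differentiable_has_grad f : (forall x, differentiable f x) -> has_grad f.
Proof.
move=> df x v; apply: DeriveDef; first exact: diff_derivable.
rewrite deriveE // {1}[v]row_sum_delta linear_sum dotE.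
by apply: eq_bigr => j _; rewrite linearZ /= mxE deriveE // mulrC.
Qed.

(** A vector field that yields the directional derivatives is the gradient. *)
Lemma grad_unique f (g : 'rV[R]_d -> 'rV[R]_d) :
  (forall x v, is_derive x v f (dot (g x) v)) -> forall x, grad f x = g x.
Proof.
move=> fg x; apply/rowP => j; rewrite mxE derive_val.
by rewrite /dot trmx_delta -colE mxE.
Qed.

Lemma is_derive_line f x v t D :
  is_derive (x + t *: v) v f D -> is_derive t 1 (fun s => f (x + s *: v)) D.
Proof.
have quotE : (fun h : R => h^-1 *: (((fun s => f (x + s *: v)) \o shift t) (h *: 1)
                 - f (x + t *: v))) =
    (fun h : R => h^-1 *: ((f \o shift (x + t *: v)) (h *: v) - f (x + t *: v))).
  apply: funext => h /=; congr (_ *: (f _ - _)).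
  by rewrite [h *: 1]mulr1 scalerDl addrCA.
case=> dfv fD; apply: DeriveDef; first by rewrite /derivable quotE.
by rewrite /derive quotE.
Qed.

(** The tangent lower bound, f y >= f x + <grad f x, y - x> + mu/2 |x - y|^2,
    where D stands for the derivative of f at x towards y. *)
Lemma strongly_convex_lower mu f x y D : 0 < mu -> strongly_convex mu f ->
  is_derive x (y - x) f D -> f x + D + mu / 2 * enorm (x - y) ^+ 2 <= f y.
Proof.
move=> mu_gt0 fconv [dfx fD].
set m := mu / 2 * _.
have m_ge0 : 0 <= m by rewrite mulr_ge0 ?sqr_ge0 // divr_ge0 // ltW.
have De e : 0 < e < 1 -> D <= f y - f x - m * (1 - e).
  move=> /andP[e_gt0 e_lt1].
  have : (fun h : R => h^-1 *: ((f \o shift x) (h *: (y - x)) - f x)) @ 0^'+ --> D.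
    by apply: cvg_dnbhs_at_right; rewrite -fD; exact: dfx.
  move=> /cvgr_to_le; apply; near=> t.
  have t_gt0 : 0 < t by near: t; exact: nbhs_right_gt.
  have t_lte : t < e by near: t; exact: nbhs_right_lt.
  rewrite /= /GRing.scale /= mulrC ler_pdivrMr //.
  have := fconv y x t; rewrite (ltW t_gt0) (ltW (lt_trans t_lte e_lt1)) => /(_ isT).
  have -> : t *: y + (1 - t) *: x = t *: (y - x) + x.
    by rewrite scalerBl scalerBr scale1r [x - _]addrC addrA.
  rewrite -(opprB x y) enormN.
  have -> : mu / 2 * t * (1 - t) * enorm (x - y) ^+ 2 = t * (1 - t) * m.
    by rewrite /m; ring.
  have : t * (1 - e) * m <= t * (1 - t) * m.
    by rewrite ler_wpM2r // ler_wpM2l ?(ltW t_gt0) //; lra.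
  by lra.
(* The bound De is passed to the limit e -> 0: if the claim failed by g > 0,
   it would be contradicted by any e < 1 with m e < g. *)
rewrite leNgt; apply/negP => lt_fy.
pose e := (f x + D + m - f y) / (2 * (m + (f x + D + m - f y))).
have := De e; set g := f x + D + m - f y in e *.
have g_gt0 : 0 < g by rewrite /g; lra.
have me : m * e < g.
  rewrite /e mulrA ltr_pdivrMr; last by lra.
  nra.
have e01 : 0 < e < 1.
  by rewrite divr_gt0 ?ltr_pdivrMr //=; lra.
by move=> /(_ e01); rewrite /g in me; lra.
Unshelve. all: by end_near.
Qed.

Lemma strongly_convex_grad_mono mu f x y : 0 < mu -> strongly_convex mu f ->
  has_grad f -> mu * enorm (x - y) ^+ 2 <= dot (grad f x - grad f y) (x - y).
Proof.
move=> mu_gt0 fconv fg.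
have := strongly_convex_lower mu_gt0 fconv (fg x (y - x)).
have := strongly_convex_lower mu_gt0 fconv (fg y (x - y)).
rewrite -(opprB x y) enormN !(psformNr dotP) (psformBl dotP); lra.
Qed.

(** The tangent lower bound at x is added to the quadratic growth
    f x >= f xs + mu/2 |x - xs|^2 of f at its minimizer. *)
Lemma strongly_convex_minimizer mu f x xs : 0 < mu -> strongly_convex mu f ->
  has_grad f -> minimizer f xs -> mu * enorm (x - xs) <= enorm (grad f x).
Proof.
move=> mu_gt0 fconv fg fmin_xs.
have lower := strongly_convex_lower mu_gt0 fconv (fg x (xs - x)).
set a := mu / 2 * enorm (x - xs) ^+ 2 in lower.
have a_ge0 : 0 <= a by rewrite mulr_ge0 ?sqr_ge0 // divr_ge0 // ltW.
have growth t : 0 < t <= 1 -> a * (1 - t) <= f x - f xs.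
  move=> /andP[t_gt0 t_le1].
  have := fconv x xs t; rewrite (ltW t_gt0) t_le1 => /(_ isT).
  have := fmin_xs (t *: x + (1 - t) *: xs).
  have -> : mu / 2 * t * (1 - t) * enorm (x - xs) ^+ 2 = t * (a * (1 - t)).
    by rewrite /a; ring.
  move=> le1 le2; rewrite -(ler_pM2l t_gt0); lra.
(* Quadratic growth is growth at t = 0, reached by continuity in t. *)
have fx_ge : a <= f x - f xs.
  rewrite leNgt; apply/negP => lt_a; set b := f x - f xs in growth lt_a.
  have b_ge0 : 0 <= b by rewrite subr_ge0.
  have := growth ((a - b) / (2 * a)).
  have -> : a * (1 - (a - b) / (2 * a)) = (a + b) / 2 by field; lra.
  have -> : 0 < (a - b) / (2 * a) <= 1.
    by rewrite divr_gt0 ?ler_pdivrMr //=; lra.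
  by move=> /(_ isT); lra.
have : mu * enorm (x - xs) ^+ 2 <= enorm (grad f x) * enorm (x - xs).
  apply: le_trans _ (dot_le_enorm _ _).
  have aE : mu * enorm (x - xs) ^+ 2 = 2 * a by rewrite /a; field.
  by rewrite -(opprB x xs) (psformNr dotP) in lower; lra.
have [->|xxs] := eqVneq x xs.
  move=> _; rewrite subrr -(scale0r (0 : 'rV[R]_d)) enormZ normr0 mul0r mulr0.
  exact: enorm_ge0.
by rewrite expr2 mulrA ler_pM2r // enorm_gt0 // subr_eq0.
Qed.

Lemma strong_convexity_le_smoothness mu L f : (0 < d)%N -> 0 < mu ->
  strongly_convex mu f -> has_grad f -> lipschitz_grad L f -> mu <= L.
Proof.
move=> d_gt0 mu_gt0 fconv fg fL; have [u u_gt0] := enorm_pos_exists d_gt0.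
have := le_trans (strongly_convex_grad_mono u 0 mu_gt0 fconv fg) (dot_le_enorm _ _).
have := fL u 0; rewrite subr0 expr2 mulrA ler_pM2r // => le1 le2.
by rewrite -(ler_pM2r u_gt0) (le_trans le2).
Qed.

(** The function phi below is nonincreasing on [0, 1]: its derivative at s is
    <grad f (x + s v) - grad f x, v> - s L |v|^2 <= 0. *)
Lemma descent_lemma f (L : R) x v : has_grad f -> lipschitz_grad L f ->
  f (x + v) <= f x + dot (grad f x) v + L / 2 * dot v v.
Proof.
move=> fg Lf.
pose a := dot (grad f x) v; pose b := dot v v.
pose phi s := f (x + s *: v) - s * a - s ^+ 2 * (L / 2 * b).
pose dphi s := dot (grad f (x + s *: v)) v - a - s * (L * b).
have phiD (s : R) : is_derive s (1 : R) phi (dphi s).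
  have line := is_derive_line (fg (x + s *: v) v).
  have -> : phi = (fun s => f (x + s *: v)) - a \*: id
                  - (L / 2 * b) \*: (id : R -> R) ^+ 2.
    by apply: funext => t; rewrite /phi !fctE /= /GRing.scale /=; ring.
  apply: is_derive_eq.
  by rewrite /dphi /GRing.scale /=; field.
have [|c /andP[c_ge0 _] phi01] := @MVT_segment R phi dphi 0 1 ler01 (fun s _ => phiD s).
  by apply: derivable_within_continuous => s _.
have : dphi c <= 0.
  rewrite /dphi -(psformBl dotP).
  have := dot_le_enorm (grad f (x + c *: v) - grad f x) v.
  have := Lf (x + c *: v) x; rewrite addrAC subrr add0r enormZ ger0_norm //.
  have := enorm_ge0 v; rewrite /b -enorm_sqr => v_ge0 le1 le2.
  have : enorm (grad f (x + c *: v) - grad f x) * enorm v <=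
     L * (c * enorm v) * enorm v by rewrite ler_wpM2r.
  by rewrite expr2; lra.
move: phi01; rewrite /phi scale1r scale0r addr0 -/a -/b; lra.
Qed.

(** The Baillon-Haddad inequality strengthened by strong convexity, which is
    the cocoercivity of the gradient of the convex, (L - mu)-smooth function
    f - mu / 2 * |.|^2. *)
Lemma grad_coercive f (mu L : R) x y : 0 < mu -> mu <= L ->
  strongly_convex mu f -> has_grad f -> lipschitz_grad L f ->
  mu * L * enorm (x - y) ^+ 2 + enorm (grad f x - grad f y) ^+ 2
    <= (mu + L) * dot (grad f x - grad f y) (x - y).
Proof.
move=> mu_gt0 mu_leL fconv fg Lf.
have lower u v := strongly_convex_lower mu_gt0 fconv (fg u (v - u)).
have upper u v := descent_lemma u v fg Lf.
move: mu_leL; rewrite le_eqVlt => /predU1P[muL|mu_ltL].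
  (* If L = mu, both terms on the left are bounded by strong monotonicity. *)
  have := strongly_convex_grad_mono x y mu_gt0 fconv fg.
  have : enorm (grad f x - grad f y) ^+ 2 <= (L * enorm (x - y)) ^+ 2.
    by rewrite ler_pXn2r ?nnegrE ?enorm_ge0 // mulr_ge0 ?enorm_ge0 // -muL ltW.
  rewrite -muL; nra.
(* The convex function h = f - mu/2 |.|^2 exceeds its tangent at u by at least
   |grad h v - grad h u|^2 / (2 (L - mu)) at v: compare the tangent bound at u
   and the descent bound at v, at the point v - p / (L - mu) where
   p = grad h v - grad h u. *)
have bregman u v : f u + dot (grad f u) (v - u) + mu / 2 * dot (v - u) (v - u)
    + (2 * (L - mu))^-1 * dot (grad f v - grad f u - mu *: (v - u))
                               (grad f v - grad f u - mu *: (v - u)) <= f v.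
  set q := v - u; set p := grad f v - grad f u - mu *: q.
  pose c := (L - mu)^-1.
  have cL : (L - mu) * c = 1 by rewrite mulfV //; lra.
  have := upper v (- (c *: p)); have := lower u (v - c *: p).
  rewrite -(opprB (v - c *: p) u) enormN enorm_sqr.
  have -> : v - c *: p - u = q - c *: p by rewrite addrAC.
  have -> : grad f v = p + grad f u + mu *: q.
    by rewrite /p addrAC !subrK.
  have -> : (2 * (L - mu))^-1 = c / 2 by rewrite /c; field; lra.
  clearbody p; clearbody q.
  rewrite !(psformE dotP) (psformC dotP p q).
  set pp := dot p p; set qq := dot q q; set pq := dot q p.
  have : L * c * c * pp = (1 + mu * c) * c * pp by rewrite -cL; ring.
  by lra.
have := bregman x y; have := bregman y x.
rewrite !enorm_sqr; set g := grad f x - grad f y.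
have -> : grad f y - grad f x = - g by rewrite opprB.
have -> : y - x = - (x - y) by rewrite opprB.
set z := x - y.
have -> : - g - mu *: - z = - (g - mu *: z) by rewrite scalerN [RHS]opprD.
rewrite !(psformNl dotP) !(psformNr dotP) !opprK.
have gE : dot g z = dot (grad f x) z - dot (grad f y) z by rewrite (psformBl dotP).
clearbody g; clearbody z; set k := dot (g - mu *: z) _.
have kE : k = dot g g - 2 * mu * dot g z + mu ^+ 2 * dot z z.
  by rewrite /k !(psformE dotP) (psformC dotP z g); ring.
move=> le1 le2.
have : (L - mu)^-1 * k <= dot g z - mu * dot z z.
  have -> : (L - mu)^-1 = 2 * (2 * (L - mu))^-1 by field; lra.
  by rewrite gE; lra.
rewrite ler_pdivrMl ?subr_gt0 // kE; lra.
Qed.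

(** The factor 1 - 2 c is at most (1 - c)^2, so that a step of at most
    2 / (L + mu) contracts with the constant 1 - c when c <= 1. *)
Lemma grad_step_contraction g (mu L c s : R) u v :
  0 < mu -> mu <= L -> strongly_convex mu g -> has_grad g -> lipschitz_grad L g ->
  0 <= s -> s * (L + mu) <= 2 -> c <= s * (mu * L / (mu + L)) ->
  enorm (u - v - s *: (grad g u - grad g v)) ^+ 2
    <= (1 - 2 * c) * enorm (u - v) ^+ 2.
Proof.
move=> mu_gt0 muL gconv gg gL s_ge0 sL cs.
have := grad_coercive u v mu_gt0 muL gconv gg gL.
set p := grad g u - grad g v; set z := u - v.
clearbody p; clearbody z.
rewrite !enorm_sqr !(psformE dotP) (psformC dotP p z).
have := psform_ge0 dotP p; have := psform_ge0 dotP z.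
set pp := dot p p; set zz := dot z z; set zp := dot z p.
move=> zz_ge0 pp_ge0 coer.
have muL_gt0 : 0 < mu + L by lra.
pose b := mu * L / (mu + L).
have : b * zz + pp / (mu + L) <= zp.
  have -> : b * zz + pp / (mu + L) = (mu * L * zz + pp) / (mu + L).
    by rewrite /b; field; lra.
  by rewrite ler_pdivrMr // [leRHS]mulrC.
move=> coer'.
have h1 : s * (b * zz + pp / (mu + L)) <= s * zp by rewrite ler_wpM2l.
have h2 : s * (s * pp) <= 2 * (s * (pp / (mu + L))).
  have -> : 2 * (s * (pp / (mu + L))) = s * (2 / (mu + L) * pp) by field; lra.
  rewrite ler_wpM2l // ler_wpM2r // ler_pdivlMr //; lra.
have h3 : c * zz <= s * b * zz by rewrite ler_wpM2r.
lra.
Qed.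

Lemma is_derive_scaled_sum n (F : 'I_n -> 'rV[R]_d -> R) (c : R) :
  (forall k, has_grad (F k)) ->
  forall x v, is_derive x v (fun z => c * \sum_k F k z)
                (dot (c *: \sum_k grad (F k) x) v).
Proof.
move=> Fg x v.
have := is_deriveZ c (is_derive_sum (fun k => Fg k x v)).
have -> : c \*: \sum_k F k = (fun z => c * \sum_k F k z).
  by apply: funext => z; rewrite /= fct_sumE.
move=> /is_derive_eq; apply; rewrite (psformZl dotP); congr (_ * _).
by rewrite /dot mulmx_suml summxE.
Qed.

Lemma aggregate_has_grad n (F : 'I_n -> 'rV[R]_d -> R) (L : 'I_n -> R) :
  (forall k, has_grad (F k)) -> (forall k, lipschitz_grad (L k) (F k)) ->
  [/\ forall x, grad (aggregate F) x = n%:R^-1 *: \sum_k grad (F k) x,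
      has_grad (aggregate F) &
      lipschitz_grad (n%:R^-1 * \sum_k L k) (aggregate F)].
Proof.
move=> Fg FL; have aggE x := grad_unique (is_derive_scaled_sum n%:R^-1 Fg) x.
split=> [//|x v|x y]; first by rewrite aggE; exact: is_derive_scaled_sum.
rewrite !aggE -scalerBr -sumrB enormZ ger0_norm ?invr_ge0 ?ler0n // -mulrA.
rewrite ler_wpM2l ?invr_ge0 ?ler0n // mulr_suml.
by apply: le_trans (enorm_sum _) _; apply: ler_sum => k _; exact: FL.
Qed.

Lemma quadratic_is_derive A (B : 'rV[R]_d) x v : A^T = A ->
  is_derive x v (quadratic A B) (dot (x *m A + B) v).
Proof.
move=> Asym.
have quadE h : quadratic A B (h *: v + x) - quadratic A B x =
    h * (dot (x *m A + B) v + h * (2^-1 * dot (v *m A) v)).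
  rewrite /quadratic -!/(dot _ _) mulmxDl -scalemxAl !(psformE dotP).
  have -> : dot (v *m A) x = dot (x *m A) v.
    by rewrite dot_mulmxl Asym (psformC dotP).
  by field.
have quotE : (fun h : R =>
    h^-1 *: ((quadratic A B \o shift x) (h *: v) - quadratic A B x)) @ 0^'
    --> dot (x *m A + B) v.
  have lin : (fun h : R => dot (x *m A + B) v + h * (2^-1 * dot (v *m A) v)) @ 0^'
      --> dot (x *m A + B) v.
    rewrite -[X in _ --> X]addr0 -[X in _ --> _ + X](mul0r (2^-1 * dot (v *m A) v)).
    apply: cvgD; first exact: cvg_cst.
    by apply: cvgMl; apply: cvg_within_filter; exact: cvg_id.
  apply: cvg_trans lin; apply: near_eq_cvg; near=> h.
  rewrite /= quadE /GRing.scale /= mulKf //.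
  by near: h; exact: nbhs_dnbhs_neq.
apply: DeriveDef; first by apply/cvg_ex; exists (dot (x *m A + B) v).
exact: cvg_lim quotE.
Unshelve. all: by end_near.
Qed.

End Gradients.

(** * The fixed points of the algorithm *)

Section FiniteExtremaTheory.
Variables (R : realType) (n : nat).
Implicit Types a : 'I_n.+1 -> R.

Lemma fmin_le a k : fmin a <= a k. Proof. exact: bigmin_le. Qed.

Lemma fmin_gt0 a : (forall k, 0 < a k) -> 0 < fmin a.
Proof. by move=> a_gt0; apply: lt_bigmin. Qed.

Lemma le_fmax a k : a k <= fmax a. Proof. exact: le_bigmax. Qed.

End FiniteExtremaTheory.

Section Algorithm.
Variables (R : realType) (n d : nat).
Variables (E : rel 'I_n.+1) (W : 'M[R]_n.+1) (pi : 'cV[R]_n.+1).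
Variables (f : 'I_n.+1 -> 'rV[R]_d -> R) (Lk : 'I_n.+1 -> R).
Hypothesis Econn : strongly_connected E.
Hypothesis Wmix : mixing_matrix E W.
Hypothesis Wpi : stationary W pi.
Implicit Types (w x y : 'M[R]_(n.+1, d)).

Let pi_gt0 j : 0 < pi j 0. Proof. by case: Wpi. Qed.
Let pi_neq0 j : pi j 0 != 0. Proof. by rewrite gt_eqF. Qed.
Local Notation N := (n.+1%:R : R).
Let N_gt0 : 0 < N. Proof. by rewrite ltr0Sn. Qed.
Let N_neq0 : N != 0. Proof. by rewrite gt_eqF. Qed.
Local Notation ones := (const_mx 1 : 'rV[R]_n.+1).

(** The stacked gradients of the f_k at the rescaled blocks w_k / (n pi_k). *)
Definition scaled_gradF w : 'M[R]_(n.+1, d) :=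
  \matrix_(k < n.+1) grad (f k) ((N * pi k 0)^-1 *: row k w).

Lemma J_mulmx w : J W w = W *m w.
Proof.
apply/matrixP => k i; rewrite !mxE summxE; apply: eq_bigr => j _.
by rewrite !mxE.
Qed.

Lemma T_mulmx alpha w : T W pi f alpha w = W *m (w - alpha *: scaled_gradF w).
Proof.
apply/matrixP => k i; rewrite !mxE summxE; apply: eq_bigr => j _.
by rewrite !mxE.
Qed.

Lemma scaled_gradF0 : scaled_gradF 0 = gradF f 0.
Proof. by apply/row_matrixP => k; rewrite !rowK row0 scaler0. Qed.

Lemma T_sub alpha x y : T W pi f alpha x - T W pi f alpha y =
  W *m (x - y - alpha *: (scaled_gradF x - scaled_gradF y)).
Proof.
rewrite !T_mulmx -mulmxBr; congr (_ *m _).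
by rewrite scalerBr !opprD !opprK addrACA.
Qed.

Lemma ones_mulW : ones *m W = ones.
Proof.
apply/rowP => j; rewrite !mxE; case: Wmix => _ _ W1; rewrite -[RHS](W1 j).
by apply: eq_bigr => k _; rewrite mxE mul1r.
Qed.

(** In the variables w_k / (n pi_k), the map w - alpha * scaled_gradF w is in
    each block a gradient step of length alpha / (n pi_k), and W is
    nonexpansive. *)
Lemma case1_contraction muk alpha0 C alpha : (0 < d)%N ->
  case1 pi f Lk alpha0 C muk -> 0 < alpha <= alpha0 ->
  forall x y, bnorm pi (T W pi f alpha x - T W pi f alpha y)
    <= (1 - alpha * C) * bnorm pi (x - y).
Proof.
move=> d_gt0 [mu_gt0 fconv fsmooth -> ->] /andP[alpha_gt0 alpha_le] x y.
set C' := fmin _.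
have fg k : has_grad (f k) by apply: differentiable_has_grad; case: (fsmooth k).
have fL k : lipschitz_grad (Lk k) (f k) by case: (fsmooth k).
have muL k : muk k <= Lk k.
  exact: strong_convexity_le_smoothness d_gt0 (mu_gt0 k) (fconv k) (fg k) (fL k).
have stepL k : alpha * (N * pi k 0)^-1 * (Lk k + muk k) <= 2.
  have := le_trans alpha_le (fmin_le _ k); have := mu_gt0 k; have := muL k.
  move=> mL m_gt0; rewrite ler_pdivlMr; last by lra.
  move=> le1; rewrite mulrAC ler_pdivrMr ?mulr_gt0 // mulrA; exact: le1.
have stepC k : alpha * C' <= alpha * (N * pi k 0)^-1 * (muk k * Lk k / (muk k + Lk k)).
  rewrite -mulrA ler_wpM2l ?(ltW alpha_gt0) //.
  apply: le_trans (fmin_le _ k) _.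
  have := mu_gt0 k; have := muL k; move=> mL m_gt0.
  have mL_neq0 : muk k + Lk k != 0 by rewrite gt_eqF //; lra.
  rewrite le_eqVlt; apply/orP; left; apply/eqP.
  by move: (N) N_neq0 => M M_neq0; field; rewrite pi_neq0 mL_neq0.
(* alpha C is at most 2 mu L / (mu + L)^2, that is, at most 1/2. *)
have aC : 0 <= 1 - alpha * C'.
  have := stepC ord0; have := stepL ord0; have := mu_gt0 ord0; have := muL ord0.
  set s := alpha * _; set m := muk ord0; set l := Lk ord0 => mL m_gt0 sl aC.
  have ml_gt0 : 0 < m + l by lra.
  have s_le : s <= 2 / (m + l) by rewrite ler_pdivlMr // addrC.
  have : s * (m * l / (m + l)) <= 2 / (m + l) * (m * l / (m + l)).
    by rewrite ler_wpM2r // divr_ge0 ?mulr_ge0; lra.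
  have : 2 / (m + l) * (m * l / (m + l)) <= 1.
    have -> : 2 / (m + l) * (m * l / (m + l)) = 2 * m * l / (m + l) ^+ 2 by field; lra.
    by rewrite ler_pdivrMr ?exprn_gt0 //; nra.
  by lra.
rewrite T_sub; apply: le_trans (bnorm_mulW Wmix Wpi _) _.
apply: (bnorm_le_scale pi_gt0) => // j.
pose a := (N * pi j 0)^-1.
have a_gt0 : 0 < a by rewrite invr_gt0 mulr_gt0.
have rowE : row j (x - y - alpha *: (scaled_gradF x - scaled_gradF y)) =
    a^-1 *: (a *: row j x - a *: row j y - (alpha * a) *:
       (grad (f j) (a *: row j x) - grad (f j) (a *: row j y))).
  transitivity (row j x - row j y
                - alpha *: (row j (scaled_gradF x) - row j (scaled_gradF y))).
    by apply/rowP => i; rewrite !mxE.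
  rewrite !rowK -/a [RHS]scalerBr [a^-1 *: (_ - _)]scalerBr !scalerA.
  by rewrite mulVf ?gt_eqF // !scale1r mulrCA mulVf ?gt_eqF // mulr1.
have xyE : row j (x - y) = a^-1 *: (a *: row j x - a *: row j y).
  by rewrite linearB /= scalerBr !scalerA mulVf ?gt_eqF // !scale1r.
rewrite rowE xyE !enormZ !exprMn [leRHS]mulrCA ler_wpM2l ?sqr_ge0 //.
apply: (@le_trans _ _
    ((1 - 2 * (alpha * C')) * enorm (a *: row j x - a *: row j y) ^+ 2)).
  apply: grad_step_contraction (muL j) (fconv j) (fg j) (fL j) _
    (stepL j) (stepC j) => //.
  by rewrite mulr_ge0 // ltW.
rewrite ler_wpM2r ?sqr_ge0 //; have := sqr_ge0 (alpha * C'); lra.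
Qed.

(** For alpha <= alpha0 the map T_alpha is a convex combination of the
    nonexpansive map J and of the contraction T_alpha0. *)
Lemma contraction_smaller_step alpha0 eta alpha : 0 < alpha <= alpha0 ->
  (forall x y, bnorm pi (T W pi f alpha0 x - T W pi f alpha0 y)
     <= eta * bnorm pi (x - y)) ->
  forall x y, bnorm pi (T W pi f alpha x - T W pi f alpha y)
    <= (1 - alpha * ((1 - eta) / alpha0)) * bnorm pi (x - y).
Proof.
move=> /andP[alpha_gt0 alpha_le] Teta x y.
have a0_gt0 : 0 < alpha0 by apply: lt_le_trans alpha_le.
pose t := alpha / alpha0.
have t_ge0 : 0 <= t by rewrite divr_ge0 ?ltW.
have t_le1 : 0 <= 1 - t by rewrite subr_ge0 ler_pdivrMr // mul1r.
have -> : T W pi f alpha x - T W pi f alpha y =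
    (1 - t) *: (W *m (x - y)) + t *: (T W pi f alpha0 x - T W pi f alpha0 y).
  rewrite !T_sub; move: (x - y) (scaled_gradF x - scaled_gradF y) => u g.
  rewrite !scalemxAr -mulmxDr; congr (_ *m _).
  rewrite scalerBl scale1r scalerBr scalerA addrA subrK.
  by rewrite [t * alpha0]divfK // gt_eqF.
apply: le_trans (bnormD pi_gt0 _ _) _; rewrite !(bnormZ pi_gt0) !ger0_norm //.
have h1 : (1 - t) * bnorm pi (W *m (x - y)) <= (1 - t) * bnorm pi (x - y).
  by rewrite ler_wpM2l // (bnorm_mulW Wmix Wpi).
have h2 : t * bnorm pi (T W pi f alpha0 x - T W pi f alpha0 y)
    <= t * (eta * bnorm pi (x - y)) by rewrite ler_wpM2l.
have -> : alpha * ((1 - eta) / alpha0) = t * (1 - eta) by rewrite /t; ring.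
lra.
Qed.

(** The norm of n pi (x) x is n |x|, because the entries of pi sum to 1. *)
Lemma bnorm_npi_tensB (u v : 'rV[R]_d) :
  bnorm pi (npi_tens pi u - npi_tens pi v) = N * enorm (u - v).
Proof.
have b_ge0 : 0 <= N * enorm (u - v) by rewrite mulr_ge0 ?enorm_ge0 // ltW.
rewrite -[RHS]ger0_norm // -sqrtr_sqr; congr (Num.sqrt _).
transitivity (\sum_j pi j 0 * (N * enorm (u - v)) ^+ 2); last first.
  by rewrite -mulr_suml; case: Wpi => _ -> _; rewrite mul1r.
apply: eq_bigr => j _; rewrite linearB /= !rowK -scalerBr enormZ.
by rewrite gtr0_norm ?mulr_gt0 //; field.
Qed.

(** The Cauchy-Schwarz inequality for the weights 1 / pi_k. *)
Lemma weighted_sum_le x :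
  \sum_k (pi k 0)^-1 * enorm (row k x)
    <= Num.sqrt (\sum_k (pi k 0)^-1) * bnorm pi x.
Proof.
have := psform_le_norms (bdot_psd 1 pi_gt0) (const_mx 1) (\col_k enorm (row k x)).
congr (_ <= Num.sqrt _ * Num.sqrt _); apply: eq_bigr => k _.
- by rewrite dotE big_ord1 !mxE mul1r.
- by rewrite dotE big_ord1 !mxE !mulr1.
- by rewrite dotE big_ord1 !mxE -expr2.
Qed.

Section FixedPoint.
Variables (C alpha : R) (w : 'M[R]_(n.+1, d)).
Hypothesis C_gt0 : 0 < C.
Hypothesis alpha_gt0 : 0 < alpha.
Hypothesis Tcontr : forall x y,
  bnorm pi (T W pi f alpha x - T W pi f alpha y) <= (1 - alpha * C) * bnorm pi (x - y).
Hypothesis Tw : T W pi f alpha w = w.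
Hypothesis fL : forall k, lipschitz_grad (Lk k) (f k).
Hypothesis Lk_ge0 : forall k, 0 <= Lk k.

Local Notation L := (fmax Lk).
Local Notation pimin := (fmin (fun k => pi k 0)).
Local Notation G := (scaled_gradF w).
Local Notation D := (w - Winfty pi *m w).

Let L_ge0 : 0 <= L. Proof. exact: le_trans (Lk_ge0 ord0) (le_fmax _ _). Qed.

(** Compare T_alpha w = w with T_alpha 0 = - alpha J (grad F 0). *)
Lemma fixed_point_bound : bnorm pi w <= C^-1 * bnorm pi (J W (gradF f 0)).
Proof.
rewrite ler_pdivlMl //.
have := Tcontr w 0; rewrite Tw subr0.
have T0 : T W pi f alpha 0 = - (alpha *: J W (gradF f 0)).
  by rewrite T_mulmx scaled_gradF0 sub0r mulmxN -scalemxAr J_mulmx.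
have := bnormD pi_gt0 (w - T W pi f alpha 0) (T W pi f alpha 0).
rewrite subrK [in X in _ <= _ + X]T0 (bnormN pi_gt0) (bnormZ pi_gt0) gtr0_norm //.
by move=> le1 le2; rewrite -(ler_pM2l alpha_gt0); lra.
Qed.

Lemma scaled_grad_bound (r : R) : bnorm pi w <= r ->
  bnorm pi G <= L * r / (N * pimin) + bnorm pi (gradF f 0).
Proof.
move=> wr; have pimin_gt0 : 0 < pimin by exact: fmin_gt0.
have c_ge0 : 0 <= L / (N * pimin) by rewrite divr_ge0 // mulr_ge0 // ltW.
have : bnorm pi (G - scaled_gradF 0) <= L / (N * pimin) * bnorm pi w.
  apply: (bnorm_le_scale pi_gt0) => // j; rewrite -exprMn.
  rewrite ler_pXn2r ?nnegrE ?mulr_ge0 ?enorm_ge0 //.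
  rewrite linearB /= !rowK row0 scaler0; apply: le_trans (fL _ _ _) _.
  rewrite subr0 enormZ mulrA ler_wpM2r ?enorm_ge0 //.
  have a_gt0 : 0 < (N * pi j 0)^-1 by rewrite invr_gt0 mulr_gt0.
  rewrite gtr0_norm // ler_pM ?le_fmax ?(ltW a_gt0) //.
    by rewrite lef_pV2 ?posrE ?mulr_gt0 // ler_pM2l // fmin_le.
  by rewrite invr_ge0 mulr_ge0 // ltW.
have : L / (N * pimin) * bnorm pi w <= L / (N * pimin) * r by rewrite ler_wpM2l.
have := bnormD pi_gt0 (G - scaled_gradF 0) (scaled_gradF 0).
rewrite subrK scaled_gradF0 [L * r / _]mulrAC.
move=> le1 le2 le3; apply: le_trans le1 _.
by rewrite lerD2r (le_trans le3).
Qed.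

(** W preserves sums over the nodes, so that at a fixed point the gradients
    must sum to zero. *)
Lemma ones_scaled_grad : ones *m G = 0.
Proof.
have : alpha *: (ones *m G) = 0.
  have := congr1 (mulmx ones) Tw.
  rewrite T_mulmx mulmxA ones_mulW mulmxBr -scalemxAr => /eqP.
  by rewrite subr_eq addrC -subr_eq subrr eq_sym => /eqP.
by move=> /eqP; rewrite scaler_eq0 gt_eqF //= => /eqP.
Qed.

(** As Winfty G = 0, the deviation from consensus D satisfies
    D = (W - Winfty) (D - alpha G). *)
Lemma consensus_bound :
  bnorm pi D <= alpha * rho W pi / (1 - rho W pi) * bnorm pi G.
Proof.
have r_ge0 := rho_ge0 Econn Wmix Wpi; have r_lt1 := rho_lt1 Econn Wmix Wpi.
have WG : Winfty pi *m G = 0 by rewrite -mulmxA ones_scaled_grad mulmx0.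
have DE : D = (W - Winfty pi) *m D - alpha *: ((W - Winfty pi) *m G).
  have idem : Winfty pi *m (w - Winfty pi *m w) = 0.
    rewrite mulmxBr !mulmxA -[Winfty pi *m pi]mulmxA.
    have -> : (const_mx 1 : 'rV[R]_n.+1) *m pi = 1%:M.
      rewrite [LHS]mx11_scalar mxE; congr (_%:M).
      case: Wpi => _ pi1 _; rewrite -[RHS]pi1.
      by apply: eq_bigr => j _; rewrite mxE mul1r.
    by rewrite mulmx1 subrr.
  rewrite !(mulW_sub_Winfty Wpi) idem WG !subr0 mulmxBr.
  have -> : W *m (Winfty pi *m w) = Winfty pi *m w.
    by rewrite !mulmxA; case: Wpi => ->.
  rewrite addrAC; congr (_ - _).
  by rewrite -[LHS]Tw T_mulmx mulmxBr -scalemxAr.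
have : bnorm pi D <= rho W pi * bnorm pi D + alpha * (rho W pi * bnorm pi G).
  rewrite {1}DE; apply: le_trans (bnormB pi_gt0 _ _) _.
  rewrite (bnormZ pi_gt0) gtr0_norm // lerD ?(bnorm_rho Econn Wmix Wpi) //.
  by rewrite ler_pM2l // (bnorm_rho Econn Wmix Wpi).
move=> le1; have -> : alpha * rho W pi / (1 - rho W pi) * bnorm pi G =
  alpha * (rho W pi * bnorm pi G) / (1 - rho W pi) by field; lra.
by rewrite ler_pdivlMr; lra.
Qed.

(* By Winfty_npi_tens, Winfty w is the consensus state n pi (x) xbar. *)
Local Notation xbar := (N^-1 *: (ones *m w)).

Lemma Winfty_npi_tens : Winfty pi *m w = npi_tens pi xbar.
Proof.
rewrite -mulmxA; apply/matrixP => j i; rewrite !mxE big_ord1.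
by rewrite [RHS]mulrACA mulfV // mul1r [in LHS]mxE.
Qed.

(** The mean xbar of the fixed point nearly minimizes the aggregate: as the
    gradients at w_k / (n pi_k) sum to zero, the gradient of the aggregate at
    xbar is controlled by the distances from xbar to the w_k / (n pi_k), that
    is, by the deviation from consensus. *)
Lemma optimality_gap (mu : R) xs : (forall k, has_grad (f k)) -> 0 < mu ->
  strongly_convex mu (aggregate f) -> minimizer (aggregate f) xs ->
  mu * (N * enorm (xbar - xs)) <=
    L / N * (Num.sqrt (\sum_k (pi k 0)^-1) * bnorm pi D).
Proof.
move=> fg mu_gt0 fconv fmin_xs.
have [aggE aggg _] := aggregate_has_grad fg fL.
have := strongly_convex_minimizer xbar mu_gt0 fconv aggg fmin_xs.
rewrite mulrCA; move=> /(ler_wpM2l (ltW N_gt0)) /le_trans; apply.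
have sumG : \sum_k grad (f k) ((N * pi k 0)^-1 *: row k w) = 0.
  rewrite -[RHS]ones_scaled_grad; apply/rowP => i; rewrite summxE mxE.
  by apply: eq_bigr => k _; rewrite !mxE mul1r.
have -> : grad (aggregate f) xbar = N^-1 *:
    \sum_k (grad (f k) xbar - grad (f k) ((N * pi k 0)^-1 *: row k w)).
  by rewrite sumrB sumG subr0 aggE.
rewrite enormZ gtr0_norm ?invr_gt0 // mulrA mulfV // mul1r.
apply: le_trans (enorm_sum _) _.
apply: (@le_trans _ _ (L / N * \sum_k (pi k 0)^-1 * enorm (row k D))); last first.
  by rewrite ler_wpM2l ?weighted_sum_le // divr_ge0 // ltW.
rewrite mulr_sumr; apply: ler_sum => k _; apply: le_trans (fL _ _ _) _.
have -> : xbar - (N * pi k 0)^-1 *: row k w = (N * pi k 0)^-1 *: (- row k D).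
  rewrite linearB /= Winfty_npi_tens rowK opprB scalerBr scalerA.
  by rewrite mulVf ?scale1r // mulf_neq0.
have a_gt0 : 0 < (N * pi k 0)^-1 by rewrite invr_gt0 mulr_gt0.
rewrite enormZ enormN gtr0_norm // invfM !mulrA -2!mulrA -[leRHS]mulrA -[leRHS]mulrA.
by rewrite ler_wpM2r ?le_fmax // !mulr_ge0 ?enorm_ge0 // invr_ge0 ltW.
Qed.

(** The constant gamma enters only through 0 < gamma <= mu, and the bound r on
    the norm of w is arbitrary. *)
Lemma fixed_point_error (mu gamma r : R) xs : (forall k, has_grad (f k)) ->
  0 < mu -> strongly_convex mu (aggregate f) -> minimizer (aggregate f) xs ->
  0 < gamma <= mu -> bnorm pi w <= r ->
  bnorm pi (w - npi_tens pi xs)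
    <= alpha * rho W pi / (1 - rho W pi)
       * (1 + L / gamma * Num.sqrt (\sum_(k < n.+1) (pi k 0)^-1))
       * (L * r / (N * pimin) + bnorm pi (gradF f 0)).
Proof.
move=> fg mu_gt0 fconv fmin_xs /andP[g_gt0 g_le] wr.
have r_ge0 := rho_ge0 Econn Wmix Wpi; have r_lt1 := rho_lt1 Econn Wmix Wpi.
set S := Num.sqrt _; set a := alpha * rho W pi / (1 - rho W pi).
have S_ge0 : 0 <= S by exact: sqrtr_ge0.
have a_ge0 : 0 <= a.
  by rewrite divr_ge0 ?mulr_ge0 ?(ltW alpha_gt0) //; lra.
have D_ge0 : 0 <= bnorm pi D by exact: bnorm_ge0.
have gap := optimality_gap fg mu_gt0 fconv fmin_xs; rewrite -/S in gap.
have gap' : N * enorm (xbar - xs) <= L / gamma * S * bnorm pi D.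
  have -> : L / gamma * S * bnorm pi D = L * (S * bnorm pi D) / gamma by ring.
  rewrite ler_pdivlMr //.
  have P_ge0 : 0 <= S * bnorm pi D by rewrite mulr_ge0.
  have : L / N * (S * bnorm pi D) <= L * (S * bnorm pi D).
    rewrite ler_wpM2r // ler_pdivrMr // ler_peMr //.
    by rewrite ler1n.
  have : N * enorm (xbar - xs) * gamma <= N * enorm (xbar - xs) * mu.
    by rewrite ler_wpM2l // mulr_ge0 ?enorm_ge0 // ltW.
  move=> le1 le2; apply: le_trans le1 _; rewrite mulrC.
  exact: le_trans gap le2.
have split : bnorm pi (w - npi_tens pi xs) <= bnorm pi D + N * enorm (xbar - xs).
  rewrite -bnorm_npi_tensB -Winfty_npi_tens.
  by apply: le_trans (bnormD pi_gt0 _ _); rewrite addrA subrK.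
have cons : bnorm pi D <= a * (L * r / (N * pimin) + bnorm pi (gradF f 0)).
  by apply: le_trans consensus_bound _; rewrite ler_wpM2l // scaled_grad_bound.
have c_ge0 : 0 <= 1 + L / gamma * S.
  by rewrite addr_ge0 // mulr_ge0 // divr_ge0 // ltW.
apply: (@le_trans _ _ ((1 + L / gamma * S) * bnorm pi D)).
  by apply: le_trans split _; rewrite mulrDl mul1r lerD2l.
by rewrite [a * (1 + _)]mulrC -[leRHS]mulrA ler_wpM2l.
Qed.

End FixedPoint.
End Algorithm.

(** * The error bound *)

Theorem theorem2p6 (R : realType) (n d : nat)
    (E : rel 'I_n.+1) (W : 'M[R]_n.+1) (pi : 'cV[R]_n.+1)
    (f : 'I_n.+1 -> 'rV[R]_d.+1 -> R) (Lk : 'I_n.+1 -> R)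
    (alpha0 C mu : R) (xstar : 'rV[R]_d.+1) :
  strongly_connected E ->
  mixing_matrix E W ->
  stationary W pi ->
  (exists muk, case1 pi f Lk alpha0 C muk) \/
    (exists A B eps eta, case2 W pi f Lk alpha0 C A B eps eta) ->
  0 < mu ->
  strongly_convex mu (aggregate f) ->
  minimizer (aggregate f) xstar ->
  forall (alpha : R) (w : 'M[R]_(n.+1, d.+1)),
    0 < alpha <= alpha0 ->
    T W pi f alpha w = w ->
    let L := fmax Lk in
    let Lbar := n.+1%:R^-1 * \sum_(k < n.+1) Lk k in
    let gamma := Lbar * mu / (Lbar + mu) in
    let Rad := C^-1 * bnorm pi (J W (gradF f 0)) in
    let Q := bnorm pi (gradF f 0) in
    let pimin := fmin (fun k => pi k 0) in
    bnorm pi (w - npi_tens pi xstar)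
      <= alpha * rho W pi / (1 - rho W pi)
         * (1 + L / gamma * Num.sqrt (\sum_(k < n.+1) (pi k 0)^-1))
         * (L * Rad / (n.+1%:R * pimin) + Q).
Proof.
move=> Econn Wmix Wpi cases mu_gt0 fconv fmin_xs alpha w alpha_le Tw.
cbv zeta; set Lbar := _ * \sum_(k < n.+1) Lk k.
have alpha_gt0 : 0 < alpha by case/andP: alpha_le.
have pi_gt0 j : 0 < pi j 0 by case: Wpi.
have [fg fL Lk_ge0 C_gt0 Tcontr] : [/\ forall k, has_grad (f k),
    forall k, lipschitz_grad (Lk k) (f k), forall k, 0 <= Lk k, 0 < C &
    forall x y, bnorm pi (T W pi f alpha x - T W pi f alpha y)
      <= (1 - alpha * C) * bnorm pi (x - y)].
  case: cases => [[muk c1]|[A [B [eps [eta c2]]]]].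
    have [muk_gt0 fsc fsm _ CE] := c1.
    have fg k : has_grad (f k) by apply: differentiable_has_grad; case: (fsm k).
    have fL k : lipschitz_grad (Lk k) (f k) by case: (fsm k).
    have Lk_gt0 k : 0 < Lk k.
      have muL : muk k <= Lk k.
        exact: strong_convexity_le_smoothness (muk_gt0 k) (fsc k) (fg k) (fL k).
      exact: lt_le_trans (muk_gt0 k) muL.
    split=> // [k||]; first exact: ltW.
    - rewrite CE; apply: fmin_gt0 => k.
      by rewrite divr_gt0 ?mulr_gt0 ?addr_gt0.
    - exact: (case1_contraction Wmix Wpi (ltn0Sn d) c1 alpha_le).
  (* The largest eigenvalue of A_k is a Lipschitz constant of its gradient. *)
  case: c2 => fquad Leig _ [/andP[_ eta_lt1] Teta] ->.
  have Apsd k : psd (A k) by case: (fquad k).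
  have fD k x v : is_derive x v (f k) (dot (x *m A k + B k) v).
    have -> : f k = quadratic (A k) (B k) by apply: funext; case: (fquad k).
    by apply: quadratic_is_derive; case: (Apsd k).
  have gradE k := grad_unique (fD k).
  split=> [k x v|k x y|k||].
  - by rewrite gradE.
  - rewrite !gradE opprD addrACA subrr addr0 -mulmxBl.
    exact: enorm_mulmx_psd.
  - exact: eigenvalue_psd_ge0 (Apsd k) (proj1 (Leig k)).
  - rewrite divr_gt0 ?subr_gt0 //.
    by apply: lt_le_trans alpha_gt0 _; case/andP: alpha_le.
  - exact: (contraction_smaller_step Wmix Wpi alpha_le Teta).
have [_ agg_g agg_L] := aggregate_has_grad fg fL.
(* The aggregate is mu-strongly convex and Lbar-smooth; this bound also makes
   Lbar positive, so that gamma > 0. *)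
have mu_leLbar : mu <= Lbar.
  exact: strong_convexity_le_smoothness (ltn0Sn d) mu_gt0 fconv agg_g agg_L.
apply: (fixed_point_error Econn Wmix Wpi alpha_gt0 Tw fL Lk_ge0 fg mu_gt0 fconv fmin_xs).
  have Lbar_gt0 : 0 < Lbar by exact: lt_le_trans mu_gt0 mu_leLbar.
  have s_gt0 : 0 < Lbar + mu by exact: addr_gt0.
  apply/andP; split; first exact: divr_gt0 (mulr_gt0 Lbar_gt0 mu_gt0) s_gt0.
  by rewrite ler_pdivrMr // [leRHS]mulrC ler_pM2r // lerDl ltW.
exact: (fixed_point_bound Wpi C_gt0 alpha_gt0 Tcontr Tw).
Qed.
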